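(* Assume that for every $i\in\{1,\dots,n-1\}$ $$1-h\gamma-h\frac{P_{\max}}{M(2\hat w_i)^{3/2}}\ge 0 .$$ If $w,w'\in X$, then $w\vee w'\in X$ and $w\wedge w'\in X$, i.e. $(X,\vee,\wedge)$ is a lattice, where $[w\vee w']_i=\max\{w_i,w_i'\}$ and $[w\wedge w']_i=\min\{w_i,w'_i\}$ for $i\in\{1,\dots,n\}$.
   Context: Let $n\ge 3$, let $h,M,P_{\max},g,\mu,\gamma>0$, $c\ge 0$, and $\alpha_1,\dots,\alpha_{n-1}\in(-\pi/2,\pi/2)$. For $i\in\{1,\dots,n-1\}$, $\hat w_i>0$ is the solution of $\frac{P_{\max}}{M\sqrt{2\hat w_i}}=g\mu\cos\alpha_i$. Let $w_{\rm in},w_{\rm fin}\ge 0$ and $w^{\max}\in\mathbb{R}^n$ with nonnegative entries. For $w\in\mathbb{R}^n$ put $f_i(w)=\frac1h(w_{i+1}-w_i)+\gamma w_i+g(\sin\alpha_i+c\cos\alpha_i)$, $i\in\{1,\dots,n-1\}$. The set $X\subset\mathbb{R}^n$ consists of all $w$ with: $f_i(w)\le \frac{P_{\max}}{M\sqrt{2w_i}}$ (read as $+\infty$ on the right when $w_i=0$), $f_i(w)\le g\mu\cos\alpha_i$ and $f_i(w)\ge -g\mu\cos\alpha_i$ for $i\in\{1,\dots,n-1\}$; $0\le w_i\le w^{\max}_i$ for $i\in\{1,\dots,n\}$; $w_1=w_{\rm in}$, $w_n=w_{\rm fin}$. *)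

(* Defs.v *)
From HB Require Import structures.
From mathcomp Require Import all_boot all_order all_algebra.
From mathcomp Require Import all_classical all_reals all_analysis.

Set Implicit Arguments.
Unset Strict Implicit.
Unset Printing Implicit Defensive.
Import Order.TTheory GRing.Theory Num.Theory.
Local Open Scope classical_set_scope.
Local Open Scope ring_scope.

(* The indices 1, ..., n of the mathematical text are 0, ..., n.-1 in 'I_n,
   and 1, ..., n-1 are 0, ..., n.-2 in 'I_n.-1: for i : 'I_n.-1, w_i is
   w 0 (idx i) and w_{i+1} is w 0 (idxS i). *)
Definition idx (n : nat) (i : 'I_n.-1) : 'I_n := widen_ord (leq_pred n) i.

Lemma idxS_subproof (n : nat) (i : 'I_n.-1) : (i.+1 < n)%N.
Proof. by rewrite -ltn_predRL. Qed.

Definition idxS (n : nat) (i : 'I_n.-1) : 'I_n := Ordinal (idxS_subproof i).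

Definition f (R : realType) (n : nat) (h g gamma c : R) (alpha : 'I_n.-1 -> R)
    (w : 'rV[R]_n) (i : 'I_n.-1) : R :=
  1 / h * (w 0 (idxS i) - w 0 (idx i)) + gamma * w 0 (idx i)
  + g * (sin (alpha i) + c * cos (alpha i)).

(* The guard is needed because a / 0 = 0 in a field of MathComp. *)
Definition power_bound (R : realType) (Pmax M x : R) : \bar R :=
  if x == 0 then +oo%E else (Pmax / (M * Num.sqrt (2 * x)))%:E.

Definition X (R : realType) (n : nat) (h M Pmax g mu gamma c : R)
    (alpha : 'I_n.-1 -> R) (win wfin : R) (wmax : 'rV[R]_n) : set 'rV[R]_n :=
  [set w : 'rV[R]_n |
    [/\ forall i : 'I_n.-1,
          [/\ ((f h g gamma c alpha w i)%:E <= power_bound Pmax M (w 0 (idx i))%R)%E,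
              f h g gamma c alpha w i <= g * mu * cos (alpha i) &
              - (g * mu * cos (alpha i)) <= f h g gamma c alpha w i],
        forall i : 'I_n, 0 <= w 0 i <= wmax 0 i,
        forall i : 'I_n, i = 0%N :> nat -> w 0 i = win &
        forall i : 'I_n, i = n.-1 :> nat -> w 0 i = wfin]].

Definition vjoin (R : realType) (n : nat) (w w' : 'rV[R]_n) : 'rV[R]_n :=
  \row_(i < n) Num.max (w 0 i) (w' 0 i).

Definition vmeet (R : realType) (n : nat) (w w' : 'rV[R]_n) : 'rV[R]_n :=
  \row_(i < n) Num.min (w 0 i) (w' 0 i).

(* MathComp's lattice structures live on types; this is the algebraic notion
   (closure, commutativity, associativity, absorption) for operations on an
   ambient type restricted to a subset. *)
Definition is_lattice (T : Type) (A : set T) (join meet : T -> T -> T) : Prop :=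
  [/\ forall x y, A x -> A y -> A (join x y) /\ A (meet x y),
      forall x y, A x -> A y -> join x y = join y x /\ meet x y = meet y x,
      forall x y z, A x -> A y -> A z ->
        join x (join y z) = join (join x y) z /\
        meet x (meet y z) = meet (meet x y) z &
      forall x y, A x -> A y ->
        join x (meet x y) = x /\ meet x (join x y) = x].

(* Main.v *)
(* The i-th block of constraints reads L(w_i) <= w_(i+1) <= phi(w_i) with L
   affine and phi(a) = (1 - h gamma) a + h min(A, P(a)) + const, where
   P(a) = Pmax / (M sqrt(2a)) and A = g mu cos alpha_i = P(what_i). Both L and
   phi are nondecreasing: min(A, P) is constant up to what_i, and beyond it P'
   is bounded below by its value at what_i, so the assumption gives phi' >= 0.
   A relation b <= phi(a) with phi nondecreasing is stable under componentwise
   max and min, and so is L(a) <= b. *)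

Require Import Defs.
From mathcomp Require Import all_boot all_order all_algebra.
From mathcomp Require Import all_classical all_reals all_analysis.
From mathcomp Require Import ring lra.

Set Implicit Arguments.
Unset Strict Implicit.
Unset Printing Implicit Defensive.
Import Order.TTheory GRing.Theory Num.Theory.
Local Open Scope classical_set_scope.
Local Open Scope ring_scope.

(** The larger of [b], [b'] is one of the two; keep its pair and enlarge the first argument to the
    max. Dually, keep the pair of the smaller of [a], [a'] and lower the second argument to the
    min. *)
Lemma monotone_rel_max_min (R : realType) (Q : R -> R -> Prop)
    (Q_mono : forall a a' b b', a <= a' -> b' <= b -> Q a b -> Q a' b')
    (a a' b b' : R) :
  Q a b -> Q a' b' ->
  Q (Num.max a a') (Num.max b b') /\ Q (Num.min a a') (Num.min b b').
Proof.
move=> Qab Qab'; split.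
- case: (leP b b') => _.
  + by apply: Q_mono Qab' => //; rewrite le_max lexx orbT.
  + by apply: Q_mono Qab => //; rewrite le_max lexx.
- case: (leP a a') => _.
  + by apply: Q_mono Qab => //; rewrite ge_min lexx.
  + by apply: Q_mono Qab' => //; rewrite ge_min lexx orbT.
Qed.

Lemma powR_3half (R : realType) (x : R) : 0 <= x ->
  x `^ (3 / 2) = Num.sqrt x ^+ 3.
Proof.
move=> x_ge0; rewrite mulrC powRrM powR12_sqrt //.
by rewrite -powR_mulrn // sqrtr_ge0.
Qed.

(** A mean value estimate in the variables [s] = sqrt(2x), [t] = sqrt(2y), done by algebra: after
    the common factor [t - s] is removed, it remains to see that [r ^+ 3] is at most [s * t] times
    the mean of [s] and [t]. *)
Lemma inv_sub_le_slope (R : realType) (r s t : R) : 0 < r -> r <= s -> s <= t ->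
  s^-1 - t^-1 <= (r ^+ 3)^-1 * ((t ^+ 2 - s ^+ 2) / 2).
Proof.
move=> r0 rs st.
have s0 : 0 < s by exact: lt_le_trans rs.
have t0 : 0 < t by exact: lt_le_trans st.
have -> : s^-1 - t^-1 = (t - s) * (s * t)^-1.
  by field; rewrite !gt_eqF.
have -> : (r ^+ 3)^-1 * ((t ^+ 2 - s ^+ 2) / 2) =
          (t - s) * ((t + s) / 2 / r ^+ 3).
  by field; rewrite gt_eqF.
apply: ler_wpM2l; first by rewrite subr_ge0.
rewrite ler_pdivlMr ?exprn_gt0 // mulrC ler_pdivrMr ?mulr_gt0 //.
have rt : r <= t by exact: le_trans st.
have h2 : r * r <= s * t by apply: ler_pM => //; exact: ltW.
have h3 : r <= (t + s) / 2 by lra.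
rewrite exprS expr2; apply: ler_pM => //; [exact: ltW|].
by rewrite mulr_ge0 // ltW.
Qed.

(** The coefficient on the right is minus the derivative of [K / Num.sqrt (2 * x)] at [v], the
    steepest descent on [v, +oo). *)
Lemma power_decrement_le (R : realType) (K v x y : R) :
  0 <= K -> 0 < v -> v <= x -> x <= y ->
  K / Num.sqrt (2 * x) - K / Num.sqrt (2 * y) <=
  K / (2 * v) `^ (3 / 2) * (y - x).
Proof.
move=> K0 v0 vx xy.
rewrite powR_3half; last by lra.
have r0 : 0 < Num.sqrt (2 * v) by rewrite sqrtr_gt0; lra.
have rs : Num.sqrt (2 * v) <= Num.sqrt (2 * x) by rewrite ler_sqrt; lra.
have st : Num.sqrt (2 * x) <= Num.sqrt (2 * y) by rewrite ler_sqrt; lra.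
have := inv_sub_le_slope r0 rs st; rewrite !sqr_sqrtr; [|lra|lra].
have -> : (2 * y - 2 * x) / 2 = y - x by field.
by move=> /(ler_wpM2l K0); rewrite mulrBr mulrA.
Qed.

Definition step (R : realType) (h gamma s a b : R) : R :=
  1 / h * (b - a) + gamma * a + s.

Lemma step_anti (R : realType) (h gamma s a a' b b' : R) :
  0 < h -> h * gamma <= 1 -> a <= a' -> b' <= b ->
  step h gamma s a' b' <= step h gamma s a b.
Proof.
move=> h0 hg aa bb; rewrite -(ler_pM2l h0).
have stepE x y : h * step h gamma s x y = y - (1 - h * gamma) * x + h * s.
  by rewrite /step; field; rewrite gt_eqF.
by rewrite !stepE lerD2r lerB // ler_wpM2l // subr_ge0.
Qed.

(** The sign condition excludes negative [a], where the square root in [power_bound] takes its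
    default value 0. *)
Definition upper_rel (R : realType) (h gamma s Pmax M A a b : R) : Prop :=
  [/\ 0 <= a,
     ((step h gamma s a b)%:E <= power_bound Pmax M a)%E &
     step h gamma s a b <= A].

Lemma upper_rel_mono (R : realType) (h gamma s Pmax M A v : R) :
  0 < h -> 0 < M -> 0 < Pmax -> 0 < v ->
  Pmax / (M * Num.sqrt (2 * v)) = A ->
  0 <= 1 - h * gamma - h * (Pmax / (M * (2 * v) `^ (3 / 2))) ->
  forall a a' b b', a <= a' -> b' <= b ->
  upper_rel h gamma s Pmax M A a b -> upper_rel h gamma s Pmax M A a' b'.
Proof.
move=> h0 M0 P0 v0 vA.
have K0 : 0 <= Pmax / M by rewrite divr_ge0 // ltW.
rewrite invfM !mulrA -/(Pmax / M) => hyp a a' b b' aa bb [a0 aP aA].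
move: vA; rewrite invfM mulrA => vA.
have pbE x : 0 < x -> power_bound Pmax M x = (Pmax / M / Num.sqrt (2 * x))%:E.
  by move=> x0; rewrite /power_bound gt_eqF // invfM mulrA.
set K := Pmax / M in K0 hyp vA pbE.
have slope0 : 0 <= K / (2 * v) `^ (3 / 2) by rewrite divr_ge0 ?powR_ge0.
have hg1 : h * gamma <= 1.
  by have := mulr_ge0 (ltW h0) slope0; move: hyp; rewrite /K !mulrA; lra.
have a'0 : 0 <= a' by exact: le_trans aa.
have a'A : step h gamma s a' b' <= A by apply: le_trans aA; exact: step_anti.
split=> //.
(* Up to [v] the power bound is at least its value [A] at [v], or infinite at 0, so the bound by [A]
   suffices. *)
have [a'v|va'] := leP a' v.
  have [->|a'n0] := eqVneq a' 0; first by rewrite /power_bound eqxx leey.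
  have a'gt0 : 0 < a' by rewrite lt_neqAle eq_sym a'n0.
  rewrite pbE // lee_fin (le_trans a'A) // -vA ler_wpM2l // lef_pV2 ?posrE
    ?sqrtr_gt0 ?ler_sqrt; lra.
(* The slope estimate holds only beyond [v], so the comparison with [a'] starts at [m]. The power
   bound holds there: by the choice of [A] if [m] is [v], by assumption if [m] is [a]. *)
pose m := Num.max a v.
have vm : v <= m by rewrite le_max lexx orbT.
have ma' : m <= a' by rewrite ge_max aa ltW.
have mP : step h gamma s m b <= K / Num.sqrt (2 * m).
  rewrite /m; case: (leP a v) => [av|va].
    by rewrite vA (le_trans _ aA)// step_anti.
  by rewrite -lee_fin -pbE // (lt_trans v0).
rewrite pbE ?(lt_trans v0) // lee_fin.
have dec := power_decrement_le K0 v0 vm ma'.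
have stepE : step h gamma s a' b =
    step h gamma s m b - (1 - h * gamma) / h * (a' - m).
  by rewrite /step; field; rewrite gt_eqF.
have slope : K / (2 * v) `^ (3 / 2) <= (1 - h * gamma) / h.
  by rewrite ler_pdivlMr // mulrC; move: hyp; rewrite /K !mulrA; lra.
have := ler_wpM2r (_ : 0 <= a' - m) slope; rewrite subr_ge0 => /(_ ma') slope'.
have := step_anti s h0 hg1 (lexx a') bb; lra.
Qed.

Theorem proposition3p1 (R : realType) (n : nat) (hn : (3 <= n)%N)
    (h M Pmax g mu gamma c : R)
    (h_gt0 : 0 < h) (M_gt0 : 0 < M) (Pmax_gt0 : 0 < Pmax) (g_gt0 : 0 < g)
    (mu_gt0 : 0 < mu) (gamma_gt0 : 0 < gamma) (c_ge0 : 0 <= c)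
    (alpha : 'I_n.-1 -> R)
    (alpha_bnd : forall i : 'I_n.-1, - (pi / 2) < alpha i < pi / 2)
    (what : 'I_n.-1 -> R)
    (what_gt0 : forall i : 'I_n.-1, 0 < what i)
    (what_sol : forall i : 'I_n.-1,
        Pmax / (M * Num.sqrt (2 * what i)) = g * mu * cos (alpha i))
    (win wfin : R) (win_ge0 : 0 <= win) (wfin_ge0 : 0 <= wfin)
    (wmax : 'rV[R]_n) (wmax_ge0 : forall i : 'I_n, 0 <= wmax 0 i)
    (hyp : forall i : 'I_n.-1,
        0 <= 1 - h * gamma - h * (Pmax / (M * (2 * what i) `^ (3 / 2)))) :
  (forall w w' : 'rV[R]_n,
      X h M Pmax g mu gamma c alpha win wfin wmax w ->
      X h M Pmax g mu gamma c alpha win wfin wmax w' ->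
      X h M Pmax g mu gamma c alpha win wfin wmax (vjoin w w') /\
      X h M Pmax g mu gamma c alpha win wfin wmax (vmeet w w')) /\
  is_lattice (X h M Pmax g mu gamma c alpha win wfin wmax)
    (@vjoin R n) (@vmeet R n).
Proof.
have closed (w w' : 'rV[R]_n) :
    X h M Pmax g mu gamma c alpha win wfin wmax w ->
    X h M Pmax g mu gamma c alpha win wfin wmax w' ->
    X h M Pmax g mu gamma c alpha win wfin wmax (vjoin w w') /\
    X h M Pmax g mu gamma c alpha win wfin wmax (vmeet w w').
  move=> [Xf Xb X0 Xn] [Xf' Xb' X0' Xn'].
  pose s i := g * (sin (alpha i) + c * cos (alpha i)).
  pose A i := g * mu * cos (alpha i).
  have upper i := monotone_rel_max_min (upper_rel_mono (s := s i) h_gt0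
    M_gt0 Pmax_gt0 (what_gt0 i) (what_sol i) (hyp i)).
  have hg1 (i : 'I_n.-1) : h * gamma <= 1.
    have : 0 <= h * (Pmax / (M * (2 * what i) `^ (3 / 2))).
      by rewrite mulr_ge0 ?divr_ge0 ?mulr_ge0 ?powR_ge0 // ltW.
    by have := hyp i; lra.
  (* For the lower bound the two entries exchange roles: [b] is now the argument that may grow. *)
  have lower_mono (i : 'I_n.-1) (b b' a a' : R) : b <= b' -> a' <= a ->
      - A i <= step h gamma (s i) a b -> - A i <= step h gamma (s i) a' b'.
    by move=> bb aa /le_trans; apply; apply: step_anti => //; exact: hg1 i.
  have lower i := monotone_rel_max_min (lower_mono i).
  have block (i : 'I_n.-1) :
      [/\ upper_rel h gamma (s i) Pmax M (A i) (w 0 (idx i)) (w 0 (idxS i)),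
          upper_rel h gamma (s i) Pmax M (A i) (w' 0 (idx i)) (w' 0 (idxS i)),
          - A i <= step h gamma (s i) (w 0 (idx i)) (w 0 (idxS i)) &
          - A i <= step h gamma (s i) (w' 0 (idx i)) (w' 0 (idxS i))].
    have [fP fA fL] := Xf i; have [fP' fA' fL'] := Xf' i.
    have /andP[w0 _] := Xb (idx i); have /andP[w'0 _] := Xb' (idx i).
    (* [f] at a vector is convertible to [step] at its two neighbouring entries. *)
    by [].
  split; split.
  - move=> i; have [u u' l l'] := block i.
    have [[_ P1 A1] _] := upper i _ _ _ _ u u'.
    have [L1 _] := lower i _ _ _ _ l l'.
    by rewrite /f !mxE.
  - move=> i; rewrite !mxE; have /andP[p q] := Xb i; have /andP[p' q'] := Xb' i.
    by rewrite le_max p ge_max q q'.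
  - by move=> i i0; rewrite !mxE X0 // X0' // maxxx.
  - by move=> i i0; rewrite !mxE Xn // Xn' // maxxx.
  - move=> i; have [u u' l l'] := block i.
    have [_ [_ P1 A1]] := upper i _ _ _ _ u u'.
    have [_ L1] := lower i _ _ _ _ l l'.
    by rewrite /f !mxE.
  - move=> i; rewrite !mxE; have /andP[p q] := Xb i; have /andP[p' q'] := Xb' i.
    by rewrite le_min p p' ge_min q.
  - by move=> i i0; rewrite !mxE X0 // X0' // minxx.
  - by move=> i i0; rewrite !mxE Xn // Xn' // minxx.
split=> //; split=> //.
- by move=> x y _ _; split; apply/rowP => i; rewrite !mxE; [exact: maxC|exact: minC].
- by move=> x y z _ _ _; split; apply/rowP => i; rewrite !mxE;
    [exact: maxA|exact: minA].
- by move=> x y _ _; split; apply/rowP => i; rewrite !mxE;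
    case: (leP (x 0 i) (y 0 i)) => xy; rewrite ?maxxx ?minxx //;
    [exact/max_idPl/ltW | exact/min_idPl].
Qed.
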